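(* (Three-term relations.) Let $\mu$ be a quasi-definite complex Borel measure on $\mathbb{T}^D$, let $n=(n_{-1},\dots,n_{-D},n_D,\dots,n_1)^\top\in\mathbb{C}^{2D}$, $L_n(z)=\sum_{a=1}^D\big(n_{-a}z_a^{-1}+n_az_a\big)$ and $\nu=\sum_{a=1}^D\big(n_{-a}\Upsilon_a^{-1}+n_a\Upsilon_a\big)$. Then for all $k$ and $z\in(\mathbb{C}^* )^D$ (terms with block index $-1$ being absent when $k=0$), $$L_n(z)\phi_{[k]}(z)=H_{[k]}\nu_{[k],[k-1]}H_{[k-1]}^{-1}\phi_{[k-1]}(z)+\big(\beta_{[k]}\nu_{[k-1],[k]}-\nu_{[k],[k+1]}\beta_{[k+1]}\big)\phi_{[k]}(z)+\nu_{[k],[k+1]}\phi_{[k+1]}(z),$$ $$L_n(z)\hat\phi_{[k]}(z)=H_{[k]}^\dagger\nu_{[k],[k-1]}(H_{[k-1]}^{-1})^\dagger\hat\phi_{[k-1]}(z)+\big(\hat\beta_{[k]}\nu_{[k-1],[k]}-\nu_{[k],[k+1]}\hat\beta_{[k+1]}\big)\hat\phi_{[k]}(z)+\nu_{[k],[k+1]}\hat\phi_{[k+1]}(z),$$ and $$L_n(z)\bar{\hat\phi}_{[k]}(z^{-1})=H_{[k]}^\top(\eta\nu)_{[k],[k-1]}H_{[k-1]}^{-1}\phi_{[k-1]}(z)+\big(\overline{\hat\beta}_{[k]}(\eta\nu)_{[k-1],[k]}-(\eta\nu)_{[k],[k+1]}\beta_{[k+1]}\big)\phi_{[k]}(z)+(\eta\nu)_{[k],[k+1]}\phi_{[k+1]}(z),$$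 $$L_n(z)\phi_{[k]}(z^{-1})=H_{[k]}(\eta\nu)_{[k],[k-1]}(H_{[k-1]}^\top)^{-1}\bar{\hat\phi}_{[k-1]}(z)+\big(\beta_{[k]}(\eta\nu)_{[k-1],[k]}-(\eta\nu)_{[k],[k+1]}\overline{\hat\beta}_{[k+1]}\big)\bar{\hat\phi}_{[k]}(z)+(\eta\nu)_{[k],[k+1]}\bar{\hat\phi}_{[k+1]}(z).$$
   Context: Let $D\ge1$, $z(\theta)=(e^{i\theta_1},\dots,e^{i\theta_D})$. For $\alpha\in\mathbb{Z}^D$ put $|\alpha|=\sum_a|\alpha_a|$, $z^\alpha=\prod_a z_a^{\alpha_a}$, $[k]=\{\alpha:|\alpha|=k\}$. Multi-indices are ordered by $|\alpha|$ and lexicographically inside each $[k]$; $\chi(z)$ is the semi-infinite column of all monomials $z^\alpha$ in this order. Semi-infinite matrices have the corresponding block structure $A_{[k],[l]}$, and $A^{[k]}$ denotes truncation to blocks $0,\dots,k-1$. The moment matrix is $G=\oint_{\mathbb{T}^D}\chi(z(\theta))d\mu(\theta)\chi(z(\theta))^\dagger$. The measure is quasi-definite if $\det G^{[k]}\ne0$ for all $k\ge1$; then uniquely $G=S^{-1}H(\hat S^{-1})^\dagger$ with $S,\hat S$ block lower unitriangular and $H=\operatorname{diag}(H_{[0]},H_{[1]},\dots)$ block diagonal with invertible blocks. $\Phi=S\chi$, $\hat\Phi=\hat S\chi$ have blocks $\phi_{[k]},\hat\phi_{[k]}$; $\beta_{[k]}=S_{[k],[k-1]}$, $\hat\beta_{[k]}=\hat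 S_{[k],[k-1]}$ for $k\ge1$. The spectral matrices have entries $(\Upsilon_a)_{\beta,\gamma}=\delta_{\beta+e_a,\gamma}$ and $\Upsilon_a^{-1}=\Upsilon_a^\top$. The reversal matrix $\eta$ is $\eta_{\alpha,\beta}=\delta_{\alpha,-\beta}$ (block diagonal, with exchange matrices on the diagonal). A bar over a matrix is entrywise conjugation, and $\bar{\hat\phi}_{[k]}(z)$ is obtained from $\hat\phi_{[k]}(z)$ by conjugating only its coefficients; $z^{-1}=(z_1^{-1},\dots,z_D^{-1})$. *)

(* Defs.v *)
From HB Require Import structures.
From mathcomp Require Import all_boot all_order all_algebra.
From mathcomp Require Import complex.
From mathcomp Require Import all_classical all_reals all_analysis.
Import Order.TTheory GRing.Theory Num.Theory.
Import numFieldNormedType.Exports.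
Set Implicit Arguments.
Unset Strict Implicit.
Unset Printing Implicit Defensive.
Local Open Scope classical_set_scope.
Local Open Scope ring_scope.
Local Open Scope sesquilinear_scope.

(* A complex measure is a charge with values in [\bar R[i]]: a finite-valued
   countably additive set function, for the topology of R[i].  Its real and
   imaginary parts are real charges; integrals against those are defined through
   the Jordan decomposition, on which the value does not depend. *)

Section ComplexIntegral.
Context {d : measure_display} {T : measurableType d} {R : realType}.

Lemma charge_part_sigma_additive (h : R[i] -> R)
    (nu : {charge set T -> \bar R[i]}) :
  {morph h : x y / x - y} -> (forall z : R[i], (`|h z|%:C)%C <= `|z|) ->
  semi_sigma_additive (fun A => (h (fine (nu A)))%:E).
Proof.
move=> hB hle F mF tF mU.
have h0 : h 0 = 0 by rewrite -(subr0 0) hB subrr.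
have hD x y : h (x + y) = h x + h y.
  by rewrite -[y in LHS]opprK hB -[- y]sub0r hB h0 sub0r opprK.
pose s n : R[i]^o := \sum_(0 <= i < n) fine (nu (F i)).
have sE n : (\sum_(0 <= i < n) nu (F i))%E = (s n)%:E.
  rewrite /s -sumEFin; apply: eq_bigr => i _.
  by rewrite fineK// fin_num_measure.
have hsE n : (\sum_(0 <= i < n) (h (fine (nu (F i))))%:E)%E = (h (s n))%:E.
  by rewrite sumEFin /s (big_morph h hD h0).
have := charge_semi_sigma_additive (s := nu) F mF tF mU.
rewrite (funext sE) (funext hsE).
rewrite -[X in _ --> X -> _]fineK ?fin_num_measure//.
set l : R[i]^o := fine _ => sl.
apply: cvg_EFin; first by near=> n.
have {}sl : s @ \oo --> l.
  move=> A Al; exact: (sl [set x | A (fine x)] Al).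
apply/cvgrPdist_lt => e e0.
have eC : 0 < (e%:C)%C :> R[i] by rewrite ltcR.
move/cvgrPdist_lt : sl => /(_ _ eC); apply: filterS => n /=.
rewrite -hB => sn; rewrite -ltcR; exact: le_lt_trans (hle _) sn.
Unshelve. all: by end_near.
Qed.

Definition charge_Re (nu : {charge set T -> \bar R[i]}) : set T -> \bar R :=
  fun A => (complex.Re (fine (nu A)))%:E.

Definition charge_Im (nu : {charge set T -> \bar R[i]}) : set T -> \bar R :=
  fun A => (complex.Im (fine (nu A)))%:E.

Section Parts.
Variable nu : {charge set T -> \bar R[i]}.

Let charge_Re0 : charge_Re nu set0 = 0%E.
Proof. by rewrite /charge_Re charge0. Qed.

Let charge_Re_fin A : measurable A -> charge_Re nu A \is a fin_num.
Proof. by []. Qed.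

Let charge_Re_sigma_additive : semi_sigma_additive (charge_Re nu).
Proof.
apply: charge_part_sigma_additive => [[a b] [c e]//|[a b]].
by rewrite normc_def lecR -sqrtr_sqr ler_wsqrtr// lerDl sqr_ge0.
Qed.

HB.instance Definition _ := isCharge.Build _ _ _ (charge_Re nu)
  charge_Re0 charge_Re_fin charge_Re_sigma_additive.

Let charge_Im0 : charge_Im nu set0 = 0%E.
Proof. by rewrite /charge_Im charge0. Qed.

Let charge_Im_fin A : measurable A -> charge_Im nu A \is a fin_num.
Proof. by []. Qed.

Let charge_Im_sigma_additive : semi_sigma_additive (charge_Im nu).
Proof.
apply: charge_part_sigma_additive => [[a b] [c e]//|[a b]].
by rewrite normc_def lecR -sqrtr_sqr ler_wsqrtr// lerDr sqr_ge0.
Qed.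

HB.instance Definition _ := isCharge.Build _ _ _ (charge_Im nu)
  charge_Im0 charge_Im_fin charge_Im_sigma_additive.

End Parts.

Lemma Hahn_decomposition_pair (nu : {charge set T -> \bar R}) :
  exists PN : set T * set T, hahn_decomposition nu PN.1 PN.2.
Proof. by have [P [N PN]] := Hahn_decomposition nu; exists (P, N). Qed.

Definition charge_integral (nu : {charge set T -> \bar R}) (f : T -> R) : R :=
  let PN := svalP (cid (Hahn_decomposition_pair nu)) in
  \int[jordan_pos PN]_x f x - \int[jordan_neg PN]_x f x.

Definition complex_integral (nu : {charge set T -> \bar R[i]}) (f : T -> R[i]) :
    R[i] :=
  Complex
    (charge_integral (charge_Re nu) (fun x => complex.Re (f x))
       - charge_integral (charge_Im nu) (fun x => complex.Im (f x)))
    (charge_integral (charge_Re nu) (fun x => complex.Im (f x))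
       + charge_integral (charge_Im nu) (fun x => complex.Re (f x))).

End ComplexIntegral.

Section Torus.
Variables (R : realType) (D : nat).

(* [R[i]^o] is R[i] with its normed topology; matrices over it carry the
   product topology. *)
Definition torus := {z : 'rV[R[i]^o]_D | [forall a, `|z 0 a| == 1]}.

HB.instance Definition _ := Choice.on torus.

Lemma torus_point_subproof : [forall a, `|(const_mx 1 : 'rV[R[i]^o]_D) 0 a| == 1].
Proof. by apply/forallP => a; rewrite mxE normr1. Qed.

HB.instance Definition _ :=
  isPointed.Build torus (exist _ (const_mx 1) torus_point_subproof).

Definition torus_val (t : torus) : 'rV[R[i]]_D := val t.

Definition torus_open : set (set torus) :=
  [set torus_val @^-1` U | U in @open 'rV[R[i]^o]_D].

Definition borel_torus := g_sigma_algebraType torus_open.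

End Torus.

Section Shells.
Variable D : nat.
Local Notation idx := 'rV[int]_D.

Definition deg (alpha : idx) : nat := (\sum_a `|alpha 0%R a|)%N.

Definition lexi_key (alpha : idx) : seqlexi int :=
  [seq alpha 0 a | a <- enum 'I_D].

Definition lexi_le : rel idx :=
  fun alpha beta => (lexi_key alpha <= lexi_key beta)%O.

Definition cube (k : nat) : seq idx :=
  [seq \row_a ((f a)%:Z - k%:Z) | f : {ffun 'I_D -> 'I_k.*2.+1}].

(* [k] as an increasing sequence: every multi-index of length k has its entries
   between - k and k. *)
Definition shell (k : nat) : seq idx :=
  sort lexi_le [seq alpha <- cube k | deg alpha == k].

Definition shells_below (k : nat) : seq idx :=
  flatten [seq shell j | j <- iota 0 k].

Lemma mem_shell k alpha : (alpha \in shell k) = (deg alpha == k).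
Proof.
rewrite mem_sort mem_filter andb_idr// => /eqP dk.
have le_ak a : - k%:Z <= alpha 0 a <= k%:Z.
  by rewrite -ler_norml -abszE lez_nat -dk /deg (bigD1 a)//= leq_addr.
have ge0_ak a : 0 <= alpha 0 a + k%:Z.
  by rewrite -lerBlDr sub0r; case/andP: (le_ak a).
have lt_ak a : (`|(alpha 0 a + k%:Z)%R|%N < k.*2.+1)%N.
  rewrite ltnS -lez_nat gez0_abs// -addnn PoszD lerD2r.
  by case/andP: (le_ak a).
apply/mapP; exists [ffun a => Ordinal (lt_ak a)]; first by rewrite mem_enum.
by apply/rowP => a; rewrite !mxE ffunE /= gez0_abs// addrK.
Qed.

Lemma shell_uniq k : uniq (shell k).
Proof.
rewrite sort_uniq filter_uniq// map_inj_uniq ?enum_uniq// => f g fg.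
apply/ffunP => a; apply/val_inj/eqP; rewrite -eqz_nat.
by move/rowP : fg => /(_ a); rewrite !mxE => /addIr ->.
Qed.

End Shells.

Section SemiInfinite.
Variables (C : numClosedFieldType) (D : nat).
Local Notation idx := 'rV[int]_D.

(* A semi-infinite matrix is a function of two multi-indices; the ordering of
   the multi-indices enters when finite matrices are extracted from it. *)
Definition simx := idx -> idx -> C.
Implicit Types A B S : simx.

Definition submx_seq A (s t : seq idx) : 'M[C]_(size s, size t) :=
  \matrix_(i, j) A (tnth (in_tuple s) i) (tnth (in_tuple t) j).

Definition blk A (k l : nat) : 'M[C]_(size (shell D k), size (shell D l)) :=
  submx_seq A (shell D k) (shell D l).

Definition trunc A (k : nat) : 'M[C]_(size (shells_below D k)) :=
  submx_seq A (shells_below D k) (shells_below D k).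

(* The sum is 0 when it has infinitely many nonzero terms; all the products
   below are finite sums. *)
Definition simul A B : simx :=
  fun alpha beta => \sum_(gamma \in [set: idx]) A alpha gamma * B gamma beta.

Definition si1 : simx := fun alpha beta => (alpha == beta)%:R.

Definition siconj A : simx := fun alpha beta => (A alpha beta)^*.

Definition siadj A : simx := fun alpha beta => (A beta alpha)^*.

Definition is_siinv A B : Prop := simul A B = si1 /\ simul B A = si1.

Definition block_lower_unitriangular S : Prop :=
  (forall k, blk S k k = 1%:M) /\ (forall k l, (k < l)%N -> blk S k l = 0).

Definition block_diagonal A : Prop :=
  forall k l, k != l -> blk A k l = 0.

Definition quasi_definite (G : simx) : Prop :=
  forall k, (1 <= k)%N -> \det (trunc G k) != 0.

Definition gauss_borel (G S H Sh : simx) : Prop :=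
  [/\ block_lower_unitriangular S,
      block_lower_unitriangular Sh,
      block_diagonal H,
      forall k, blk H k k \in unitmx &
      exists Si Shi : simx, [/\ is_siinv S Si, is_siinv Sh Shi &
        G = simul (simul Si H) (siadj Shi)]].

(* The first subdiagonal block S_[k],[k-1], meant for k >= 1. *)
Definition subdiag S (k : nat) := blk S k k.-1.

Definition monomial (z : 'rV[C]_D) (alpha : idx) : C :=
  \prod_a z 0 a ^ alpha 0 a.

(* The k-th block of the column S chi(z). *)
Definition oblock S (k : nat) (z : 'rV[C]_D) : 'cV[C]_(size (shell D k)) :=
  \col_i \sum_(gamma \in [set: idx])
    S (tnth (in_tuple (shell D k)) i) gamma * monomial z gamma.

Definition invz (z : 'rV[C]_D) : 'rV[C]_D := map_mx GRing.inv z.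

Definition Upsilon (a : 'I_D) : simx :=
  fun beta gamma => (beta + delta_mx 0 a == gamma)%:R.

Definition Upsilon_inv (a : 'I_D) : simx :=
  fun beta gamma => Upsilon a gamma beta.

Definition eta : simx := fun alpha beta => (alpha == - beta)%:R.

(* The components of n = (n_{-1}, ..., n_{-D}, n_D, ..., n_1). *)
Definition n_neg (n : 'cV[C]_(D + D)) (a : 'I_D) : C := n (lshift D a) 0.
Definition n_pos (n : 'cV[C]_(D + D)) (a : 'I_D) : C :=
  n (rshift D (rev_ord a)) 0.

Definition Lpoly (n : 'cV[C]_(D + D)) (z : 'rV[C]_D) : C :=
  \sum_a (n_neg n a * (z 0 a)^-1 + n_pos n a * z 0 a).

Definition nu_mx (n : 'cV[C]_(D + D)) : simx := fun alpha beta =>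
  \sum_a (n_neg n a * Upsilon_inv a alpha beta + n_pos n a * Upsilon a alpha beta).

End SemiInfinite.

Section MomentMatrix.
Variables (R : realType) (D : nat).

Definition moment_mx (mu : {charge set borel_torus R D -> \bar R[i]}) :
    simx R[i] D :=
  fun alpha beta => complex_integral mu (fun t =>
    monomial (torus_val t) alpha * (monomial (torus_val t) beta)^*).

End MomentMatrix.

(* Main.v *)
Require Import Defs.
From mathcomp Require Import all_boot all_order all_algebra.
From mathcomp Require Import complex.
From mathcomp Require Import all_classical all_reals all_analysis.
From mathcomp Require Import finmap zify.
Import GRing.Theory Num.Theory.
Local Open Scope ring_scope.
Local Open Scope sesquilinear_scope.

(* The moment matrix G depends only on the difference of its two indices, so it
   commutes with every matrix having that property, in particular with nu,
   while eta exchanges G with its transpose; thus M G1 = G2 M for M = nu or eta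
   nu and suitable G1, G2 among G, its adjoint and its transpose. Inserting the
   factorizations G1 = B^-1 K1 V^-1 and G2 = A^-1 K2 U, with A, B lower and U,
   V upper block unitriangular, gives A M B^-1 = K2 U M V K1^-1. As M only
   couples consecutive shells, this matrix is block tridiagonal: its
   superdiagonal and diagonal blocks are read off the left-hand side, its
   subdiagonal blocks off the right-hand side. Applying it to B chi gives A M
   chi, and M chi is L_n(z) times chi(z) or chi(z^-1). *)

Section SemiInfiniteAlgebra.
Context {C : numClosedFieldType} {D : nat}.
Local Notation idx := 'rV[int]_D.
Local Notation simx := (simx C D).
Implicit Types (A B M X Y Z G S H P : simx) (x w : idx -> C).

(** * Products and involutions of semi-infinite matrices *)

Definition sitr A : simx := fun alpha beta => A beta alpha.

(** One-sided: the bound concerns only columns of higher degree than the row. It makes every row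
    finitely supported, and the widths add up under products. *)
Definition row_band (c : nat) A : Prop :=
  forall alpha gamma, (deg alpha + c < deg gamma)%N -> A alpha gamma = 0.

Lemma mem_shells_below N (alpha : idx) :
  (alpha \in shells_below D N) = (deg alpha < N)%N.
Proof.
apply/flatten_mapP/idP => [[j]|dN].
  by rewrite mem_iota mem_shell => jN /eqP ->.
by exists (deg alpha); rewrite ?mem_iota// mem_shell.
Qed.

Lemma shells_below_uniq N : uniq (shells_below D N).
Proof.
elim: N => [//|N IH]; rewrite /shells_below -(addn1 N) iotaD map_cat.
rewrite flatten_cat cat_uniq IH/= cats0 shell_uniq andbT; apply/hasPn => alpha.
by rewrite mem_shell mem_shells_below => /eqP ->; rewrite add0n ltnn.
Qed.

(** The list on the right does not depend on the support of [f], so sums of several functions can be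
    compared, distributed and exchanged. *)
Lemma fsum_shells N (f : idx -> C) :
  (forall gamma, (N <= deg gamma)%N -> f gamma = 0) ->
  \sum_(gamma \in [set: idx]) f gamma =
    \sum_(gamma <- shells_below D N) f gamma.
Proof.
move=> f0; rewrite [RHS]fsbig_seq ?shells_below_uniq//; symmetry.
apply: fsbig_widen => //.
move=> gamma [_] /=; rewrite mem_shells_below => /negP; rewrite -leqNgt.
exact: f0.
Qed.

Lemma simulE A B alpha beta N :
  (forall gamma, (N <= deg gamma)%N -> A alpha gamma * B gamma beta = 0) ->
  simul A B alpha beta =
    \sum_(gamma <- shells_below D N) A alpha gamma * B gamma beta.
Proof. exact: fsum_shells. Qed.

Lemma simul_tr A B : sitr (simul A B) = simul (sitr B) (sitr A).
Proof.
apply/funext => alpha; apply/funext => beta.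
by apply: eq_fsbigr => gamma _; exact: mulrC.
Qed.

Lemma simul_conj A B : siconj (simul A B) = simul (siconj A) (siconj B).
Proof.
apply/funext => alpha; apply/funext => beta.
rewrite /siconj /simul rmorph_sum/=.
rewrite [in RHS](eq_bigr (fun g => (A alpha g * B g beta)^*)); last first.
  by move=> g _; rewrite rmorphM.
(* Each sum ranges over the support of its summand. Conjugation vanishes only at 0, so the supports
   agree, and the identity covers infinite supports, where both sums are 0. *)
congr (\sum_(_ <- _) _); rewrite /finite_support !unlock.
congr (finmap.enum_fset (fset_set _)).
apply/seteqP; split=> g /= [_ f0]; split=> //.
  by rewrite -rmorphM => /eqP; rewrite conjC_eq0 => /eqP.
by apply: contra_not f0; rewrite -rmorphM => ->; rewrite rmorph0.
Qed.

Lemma simul_adj A B : siadj (simul A B) = simul (siadj B) (siadj A).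
Proof. by rewrite -[LHS]/(sitr (siconj _)) simul_conj simul_tr. Qed.

Lemma siadjK A : siadj (siadj A) = A.
Proof. by apply/funext => ?; apply/funext => ?; rewrite /siadj conjCK. Qed.

Lemma siconj_adj A : siconj (siadj A) = sitr A.
Proof. by apply/funext => ?; apply/funext => ?; rewrite /siconj conjCK. Qed.

Lemma siconj1 : siconj (@si1 C D) = @si1 C D.
Proof.
by apply/funext => ?; apply/funext => ?; rewrite /siconj /si1 rmorph_nat.
Qed.

Lemma sitr1 : sitr (@si1 C D) = @si1 C D.
Proof. by apply/funext => ?; apply/funext => ?; rewrite /sitr /si1 eq_sym. Qed.

Lemma siadj1 : siadj (@si1 C D) = @si1 C D.
Proof. by rewrite -[LHS]/(sitr (siconj _)) siconj1 sitr1. Qed.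

Lemma simul1l A : simul (@si1 C D) A = A.
Proof.
apply/funext => alpha; apply/funext => beta; rewrite /simul.
rewrite (fsbigTE [fset alpha]%fset) ?big_seq_fset1.
  by rewrite /si1 eqxx mul1r.
by move=> g; rewrite inE eq_sym /si1 => /negPf ->; rewrite mul0r.
Qed.

Lemma simul1r A : simul A (@si1 C D) = A.
Proof. by rewrite -[LHS]/(sitr (sitr _)) simul_tr sitr1 simul1l. Qed.

Lemma simul_eta A :
  simul (@eta C D) A = (fun alpha beta => A (- alpha) beta).
Proof.
apply/funext => alpha; apply/funext => beta; rewrite /simul.
rewrite (fsbigTE [fset - alpha]%fset) ?big_seq_fset1.
  by rewrite /eta opprK eqxx mul1r.
by move=> g; rewrite inE eq_sym /eta eqr_oppLR => /negPf ->; rewrite mul0r.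
Qed.

(* [simul] is not associative in general, as infinite sums have value 0; here
   only finitely many terms of the double sum are nonzero. *)
Lemma simulA_at X Y Z alpha beta N1 N2 :
  (forall gamma, (N1 <= deg gamma)%N -> X alpha gamma = 0) ->
  (forall gamma delta, (deg gamma < N1)%N -> (N2 <= deg delta)%N ->
     Y gamma delta * Z delta beta = 0) ->
  simul X (simul Y Z) alpha beta = simul (simul X Y) Z alpha beta.
Proof.
move=> X0 YZ0.
have XYE delta : simul X Y alpha delta =
    \sum_(gamma <- shells_below D N1) X alpha gamma * Y gamma delta.
  by apply: simulE => gamma /X0 ->; rewrite mul0r.
rewrite (@simulE X _ _ _ N1); last by move=> gamma /X0 ->; rewrite mul0r.
rewrite (@simulE _ Z _ _ N2); last first.
  move=> delta dN; rewrite XYE mulr_suml big_seq big1// => gamma.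
  by rewrite mem_shells_below => gN; rewrite -mulrA YZ0 ?mulr0.
under [RHS]eq_bigr do rewrite XYE mulr_suml.
rewrite exchange_big/= big_seq [RHS]big_seq; apply: eq_bigr => gamma.
rewrite mem_shells_below => gN; rewrite (@simulE Y _ _ _ N2) ?mulr_sumr.
  by apply: eq_bigr => delta _; rewrite mulrA.
by move=> delta; exact: YZ0.
Qed.

(** * Associativity with banded factors *)

Lemma simulA_row {c d X Y Z} : row_band c X -> row_band d Y ->
  simul X (simul Y Z) = simul (simul X Y) Z.
Proof.
move=> Xc Yd; apply/funext => alpha; apply/funext => beta.
apply: (@simulA_at _ _ _ _ _ (deg alpha + c).+1 (deg alpha + c + d).+1).
  by move=> gamma; exact: Xc.
move=> gamma delta gN dN; rewrite Yd ?mul0r//.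
by apply: leq_trans dN; rewrite ltnS leq_add2r -ltnS.
Qed.

Lemma simulA_col {c d X Y Z} : row_band c (sitr Y) -> row_band d (sitr Z) ->
  simul X (simul Y Z) = simul (simul X Y) Z.
Proof.
move=> Yc Zd; suff /(congr1 sitr) :
  sitr (simul X (simul Y Z)) = sitr (simul (simul X Y) Z) by [].
by rewrite !simul_tr (simulA_row Zd Yc).
Qed.

(** The rows of [X] bound the first summation index and the columns of [Z] the second, so the middle
    factor may be a full matrix. *)
Lemma simulA_row_col {c d X Y Z} : row_band c X -> row_band d (sitr Z) ->
  simul X (simul Y Z) = simul (simul X Y) Z.
Proof.
move=> Xc Zd; apply/funext => alpha; apply/funext => beta.
apply: (@simulA_at _ _ _ _ _ (deg alpha + c).+1 (deg beta + d).+1).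
  by move=> gamma; exact: Xc.
by move=> gamma delta _ dN; rewrite [Z _ _]Zd ?mulr0.
Qed.

Lemma row_band_simul {c d A B} : row_band c A -> row_band d B ->
  row_band (c + d) (simul A B).
Proof.
move=> Ac Bd alpha beta ab; apply: fsbig1 => gamma _.
have [/Ac ->|le_g] := ltnP (deg alpha + c) (deg gamma); first by rewrite mul0r.
by rewrite Bd ?mulr0// (leq_ltn_trans _ ab)// addnA leq_add2r.
Qed.

(** * Blocks of matrices and of columns *)

Lemma blk_eqP A B k l :
  blk A k l = blk B k l <->
  (forall alpha beta, deg alpha = k -> deg beta = l ->
     A alpha beta = B alpha beta).
Proof.
split=> [/matrixP E alpha beta /eqP + /eqP|E].
  rewrite -!mem_shell => /seq_tnthP[i ->] /seq_tnthP[j ->].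
  by have := E i j; rewrite !mxE.
apply/matrixP => i j; rewrite !mxE.
by apply: E; apply/eqP; rewrite -mem_shell mem_tnth.
Qed.

Definition si0 : simx := fun _ _ => 0.

Lemma blk0 k l : blk si0 k l = 0.
Proof. by apply/matrixP => i j; rewrite !mxE. Qed.

Lemma blk1 k : blk (@si1 C D) k k = 1%:M.
Proof.
apply/matrixP => i j; rewrite !mxE /si1; congr (_%:R).
by rewrite !(tnth_nth 0) /= nth_uniq ?shell_uniq.
Qed.

Lemma blk1_neq k l : k != l -> blk (@si1 C D) k l = 0.
Proof.
move=> kl; rewrite -blk0; apply/blk_eqP => alpha beta ak bl; rewrite /si1.
by case: eqP => // ab; rewrite -ak -bl ab eqxx in kl.
Qed.

Lemma row_bandP c A :
  row_band c A <-> (forall k l, (k + c < l)%N -> blk A k l = 0).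
Proof.
split=> [Ac k l kl|A0 alpha beta ab].
  by rewrite -blk0; apply/blk_eqP => alpha beta ak bl; rewrite Ac// ak bl.
by move: (A0 _ _ ab); rewrite -blk0 => /blk_eqP ->.
Qed.

Lemma blk_tr A k l : blk (sitr A) k l = (blk A l k)^T.
Proof. by apply/matrixP => i j; rewrite !mxE. Qed.

Lemma blk_conj A k l : blk (siconj A) k l = map_mx Num.conj (blk A k l).
Proof. by apply/matrixP => i j; rewrite !mxE. Qed.

Lemma blk_adj A k l : blk (siadj A) k l = (blk A l k)^t*.
Proof. by apply/matrixP => i j; rewrite !mxE. Qed.

Lemma submx_seq_simul A B (s t : seq idx) N :
  (forall alpha beta gamma, alpha \in s -> (N <= deg gamma)%N ->
     A alpha gamma * B gamma beta = 0) ->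
  submx_seq (simul A B) s t =
    \sum_(j < N) submx_seq A s (shell D j) *m submx_seq B (shell D j) t.
Proof.
move=> AB0; apply/matrixP => p q; rewrite mxE summxE.
rewrite (@simulE _ _ _ _ N); last by move=> g; apply: AB0; rewrite mem_tnth.
rewrite big_flatten big_map -[X in iota 0 X]subn0 -/(index_iota 0 N) big_mkord.
apply: eq_bigr => j _; rewrite mxE.
by rewrite big_tnth; apply: eq_bigr => i _; rewrite !mxE.
Qed.

Lemma blk_simul c A B k l : row_band c A ->
  blk (simul A B) k l = \sum_(j < (k + c).+1) blk A k j *m blk B j l.
Proof.
move=> Ac; apply: submx_seq_simul => alpha beta gamma.
by rewrite mem_shell => /eqP <- /Ac ->; rewrite mul0r.
Qed.

(** This is [oblock] with an arbitrary column [x] in place of the monomials. *)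
Definition vblk A x (k : nat) : 'cV[C]_(size (shell D k)) :=
  \col_i \sum_(gamma \in [set: idx])
    A (tnth (in_tuple (shell D k)) i) gamma * x gamma.

(** Encodes a vector as a matrix with constant rows, so that the results on [simul] apply to it; any
    single column, such as that of index 0, recovers the vector. *)
Definition column x : simx := fun gamma _ => x gamma.

Lemma vblkE A x k :
  vblk A x k = submx_seq (simul A (column x)) (shell D k) [:: 0].
Proof. by apply/colP => i; rewrite !mxE. Qed.

Lemma vblk_simul c d A B x k : row_band c A -> row_band d B ->
  vblk (simul A B) x k = \sum_(j < (k + c).+1) blk A k j *m vblk B x j.
Proof.
move=> Ac Bd; rewrite vblkE -(simulA_row Ac Bd).
rewrite (@submx_seq_simul _ _ _ _ (k + c).+1).
  by apply: eq_bigr => j _; rewrite vblkE.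
by move=> alpha beta gamma; rewrite mem_shell => /eqP <- /Ac ->; rewrite mul0r.
Qed.

(** * Triangular matrices and Gauss-Borel factorizations *)

Lemma row_band_lut {S} : block_lower_unitriangular S -> row_band 0 S.
Proof. by move=> [_ S0]; apply/row_bandP => k l; rewrite addn0; exact: S0. Qed.

Lemma row_band_diag {H} : block_diagonal H -> row_band 0 H.
Proof.
by move=> H0; apply/row_bandP => k l; rewrite addn0 => /ltn_eqF /negbT/H0.
Qed.

(** Forward substitution: in block row [k] of [S Si = 1], the terms with [j < k] contain
    [blk Si j l] with [j < l], which vanishes by induction. *)
Lemma lut_inv {S Si} : block_lower_unitriangular S -> simul S Si = @si1 C D ->
  block_lower_unitriangular Si.
Proof.
move=> lS SSi.
have E k : forall l, (k <= l)%N -> blk Si k l = blk (@si1 C D) k l.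
  elim/ltn_ind: k => k IH l kl; rewrite -SSi (blk_simul 0) ?addn0.
    2: exact: row_band_lut.
  rewrite big_ord_recr/= (proj1 lS) mul1mx big1 ?add0r// => j _.
  have jl := leq_trans (ltn_ord j) kl.
  by rewrite IH ?(ltnW jl)// blk1_neq ?mulmx0// ltn_eqF.
split=> [k|k l kl]; first by rewrite E// blk1.
by rewrite E ?(ltnW kl)// blk1_neq// ltn_eqF.
Qed.

Lemma lut_inv_subdiag {S Si} k : block_lower_unitriangular S ->
  block_lower_unitriangular Si -> simul S Si = @si1 C D ->
  blk Si k.+1 k = - blk S k.+1 k.
Proof.
move=> lS lSi SSi; have := congr1 (fun A => blk A k.+1 k) SSi.
rewrite (blk_simul 0) ?addn0; last exact: row_band_lut.
rewrite blk1_neq ?gtn_eqF// !big_ord_recr/= big1 => [|j _].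
  2: by rewrite (proj2 lSi) ?mulmx0.
rewrite (proj1 lS) (proj1 lSi) mul1mx mulmx1 add0r => /eqP.
by rewrite addrC addr_eq0 => /eqP.
Qed.

Lemma lut_conj {S} :
  block_lower_unitriangular S -> block_lower_unitriangular (siconj S).
Proof.
move=> [S1 S0]; split=> [k|k l kl]; rewrite blk_conj.
  by rewrite S1 map_mx1.
by rewrite S0// map_mx0.
Qed.

Lemma siinv_conj {A B} : is_siinv A B -> is_siinv (siconj A) (siconj B).
Proof. by move=> [AB BA]; split; rewrite -simul_conj ?AB ?BA siconj1. Qed.

Lemma gauss_borel_conj {G S H Sh} : gauss_borel G S H Sh ->
  gauss_borel (siconj G) (siconj S) (siconj H) (siconj Sh).
Proof.
move=> [lS lSh dH uH [Si [Shi [iS iSh ->]]]]; split; try exact: lut_conj.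
- by move=> k l kl; rewrite blk_conj dH// map_mx0.
- by move=> k; rewrite blk_conj map_unitmx.
- exists (siconj Si), (siconj Shi); split; try exact: siinv_conj.
  by rewrite !simul_conj.
Qed.

(** The adjoint reverses the product of a lower, a diagonal and an upper factor into one of the same
    shape, in which [S] and [Sh] have swapped roles. *)
Lemma gauss_borel_adj {G S H Sh} : gauss_borel G S H Sh ->
  gauss_borel (siadj G) Sh (siadj H) S.
Proof.
move=> [lS lSh dH uH [Si [Shi [iS iSh ->]]]]; split=> //.
- by move=> k l kl; rewrite blk_adj dH 1?eq_sym// trmx0 map_mx0.
- by move=> k; rewrite blk_adj map_unitmx unitmx_tr.
- exists Shi, Si; split=> //; rewrite !simul_adj siadjK.
  apply: (simulA_row_col (c := 0) (d := 0)).
    by apply: row_band_lut; exact: lut_inv lSh (proj1 iSh).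
  rewrite -[sitr _]/(siconj Si).
  by apply/row_band_lut/lut_conj; exact: lut_inv lS (proj1 iS).
Qed.

Lemma gauss_borel_tr {G S H Sh} : gauss_borel G S H Sh ->
  gauss_borel (sitr G) (siconj Sh) (sitr H) (siconj S).
Proof. by move=> /gauss_borel_adj/gauss_borel_conj; rewrite !siconj_adj. Qed.

(** * Matrices that couple consecutive shells *)

Definition nearest_shell M : Prop := forall alpha beta, M alpha beta != 0 ->
  (deg beta == (deg alpha).+1) || (deg alpha == (deg beta).+1).

Lemma nearest_shell_blk M k l : nearest_shell M ->
  l != k.+1 -> k != l.+1 -> blk M k l = 0.
Proof.
move=> nM lk kl; rewrite -blk0; apply/blk_eqP => alpha beta ak bl.
apply/eqP/negPn/negP => /nM; rewrite ak bl.
by rewrite (negPf lk) (negPf kl).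
Qed.

Lemma row_band_nearest {M} : nearest_shell M -> row_band 1 M.
Proof.
move=> nM; apply/row_bandP => k l kl.
by apply: (@nearest_shell_blk M) => //; lia.
Qed.

Lemma nearest_shell_tr {M} : nearest_shell M -> nearest_shell (sitr M).
Proof. by move=> nM alpha beta /nM; rewrite orbC. Qed.

Lemma blk_simul_diag_r c A H k l : row_band c A -> block_diagonal H ->
  blk (simul A H) k l = blk A k l *m blk H l l.
Proof.
move=> Ac dH; have [kl|kl] := leqP l (k + c); last first.
  have AHc := row_band_simul Ac (row_band_diag dH).
  by rewrite !(proj1 (row_bandP _ _) _ _ _ kl) ?mul0mx// -[c]addn0.
rewrite (blk_simul c)// (bigD1 (Ordinal (kl : (l < (k + c).+1)%N)))//=.
rewrite big1 ?addr0// => j jl.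
by rewrite (dH j l) ?mulmx0//; apply: contra jl => /eqP jl; apply/eqP/val_inj.
Qed.

Lemma blk_simul_diag_l A H k l : block_diagonal H ->
  blk (simul H A) k l = blk H k k *m blk A k l.
Proof.
move=> dH; rewrite (blk_simul 0) ?addn0; last exact: row_band_diag.
by rewrite big_ord_recr/= big1 ?add0r// => j _; rewrite dH ?mul0mx// gtn_eqF.
Qed.

(** * Blocks of such a matrix between lower unitriangular factors *)

Section Dressing.
Context {A B M : simx} (lA : block_lower_unitriangular A)
  (lB : block_lower_unitriangular B) (nM : nearest_shell M).

Let bA : row_band 0 A := row_band_lut lA.
Let bAM : row_band 1 (simul A M) := row_band_simul bA (row_band_nearest nM).

Lemma row_band_dressed : row_band 1 (simul (simul A M) B).
Proof. by have := row_band_simul bAM (row_band_lut lB). Qed.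

Let blk_left_super k : blk (simul A M) k k.+1 = blk M k k.+1.
Proof.
rewrite (blk_simul 0)// addn0 big_ord_recr/= (proj1 lA) mul1mx.
rewrite big1 ?add0r// => -[j jk] _ /=.
by rewrite (nearest_shell_blk _ _ _ nM) ?mulmx0//; lia.
Qed.

Let blk_left_diag k : blk (simul A M) k k =
  if (0 < k)%N then subdiag A k *m blk M k.-1 k else 0.
Proof.
rewrite (blk_simul 0)// addn0 big_ord_recr/=.
rewrite (nearest_shell_blk _ _ k nM) ?mulmx0 ?addr0; [|lia|lia].
case: k => [|k]; first by rewrite big_ord0.
rewrite big_ord_recr/= big1 ?add0r// => -[j jk] _ /=.
by rewrite (nearest_shell_blk _ _ _ nM) ?mulmx0//; lia.
Qed.

(** Only [M] can raise the shell, and by one; the triangular factors then contribute their identity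
    blocks. *)
Lemma blk_dressed_super k : blk (simul (simul A M) B) k k.+1 = blk M k k.+1.
Proof.
rewrite (blk_simul 1)// addn1 big_ord_recr/= (proj1 lB) mulmx1 blk_left_super.
by rewrite big1 ?add0r// => -[j jk] _ /=; rewrite (proj2 lB) ?mulmx0.
Qed.

(** The step up made by [M] is compensated by one step down, taken either by [A] before it or by [B]
    after it. From shell 0 the former is impossible. *)
Lemma blk_dressed_diag k : blk (simul (simul A M) B) k k =
  (if (0 < k)%N then subdiag A k *m blk M k.-1 k else 0)
  + blk M k k.+1 *m subdiag B k.+1.
Proof.
rewrite (blk_simul 1)// addn1 !big_ord_recr/= (proj1 lB) mulmx1.
rewrite blk_left_super blk_left_diag big1 ?add0r// => -[j jk] _ /=.
by rewrite (proj2 lB) ?mulmx0.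
Qed.

End Dressing.

(** * Exchange of the two factorizations and the general three-term relation *)

Lemma dressed_exchange {M G1 G2 A B K1 K2 P1 P2} :
  nearest_shell M -> simul M G1 = simul G2 M ->
  gauss_borel G1 B K1 P1 -> gauss_borel G2 A K2 P2 ->
  exists Bi U V, [/\ is_siinv B Bi, block_lower_unitriangular (sitr U),
    block_lower_unitriangular (sitr V) &
    simul (simul (simul A M) Bi) K1 = simul K2 (simul (simul U M) V)].
Proof.
move=> nM MG [lB lP1 dK1 _ [Bi [P1i [iB iP1 G1E]]]].
move=> [lA lP2 dK2 _ [Ai [P2i [iA iP2 G2E]]]].
have bM := row_band_nearest nM.
have bMt := row_band_nearest (nearest_shell_tr nM).
have bA := row_band_lut lA; have bAi := row_band_lut (lut_inv lA (proj1 iA)).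
have bB := row_band_lut lB; have bBi := row_band_lut (lut_inv lB (proj1 iB)).
have bK1 := row_band_diag dK1; have bK2 := row_band_diag dK2.
(* By conversion, [sitr (siadj P1)] is [siconj P1]; likewise for the next two. *)
have lV : block_lower_unitriangular (sitr (siadj P1)) by exact: lut_conj.
have lVi : block_lower_unitriangular (sitr (siadj P1i)).
  exact/lut_conj/(lut_inv lP1 (proj1 iP1)).
have lU : block_lower_unitriangular (sitr (siadj P2i)).
  exact/lut_conj/(lut_inv lP2 (proj1 iP2)).
have bV := row_band_lut lV; have bVi := row_band_lut lVi.
have bU := row_band_lut lU.
exists Bi, (siadj P2i), (siadj P1); split=> //.
have bBK := row_band_simul bBi bK1; have bAK := row_band_simul bAi bK2.
(* Multiplying by [A] on the left and [siadj P1] on the right cancels the outer factor [siadj P1i]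
   of [G1] and [Ai] of [G2]. [K1] stays on the left-hand side, to be inverted later block by
   block. *)
have := congr1 (fun X => simul (simul A X) (siadj P1)) MG.
rewrite /= G1E (simulA_row bM bBK) (simulA_row bA (row_band_simul bM bBK)).
rewrite -(simulA_col bVi bV) -simul_adj (proj1 iP1) siadj1 simul1r.
rewrite (simulA_row bM bBi) (simulA_row bA (row_band_simul bM bBi)).
rewrite (simulA_row bA bM) => ->.
rewrite G2E -(simulA_col bU bMt) (simulA_row bA bAK) (simulA_row bA bAi).
by rewrite (proj1 iA) simul1l -(simulA_row_col bK2 bV).
Qed.

(** Common form of the four relations: [x] will be the monomials at z, and [w] those at z or at its
    inverse. *)
Lemma three_term {M G1 G2 A B K1 K2 P1 P2 x w} (L : C) k :
  nearest_shell M -> simul M G1 = simul G2 M ->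
  gauss_borel G1 B K1 P1 -> gauss_borel G2 A K2 P2 ->
  (forall alpha,
     \sum_(gamma \in [set: idx]) M alpha gamma * x gamma = L * w alpha) ->
  L *: vblk A w k =
    (if (0 < k)%N then
       blk K2 k k *m blk M k k.-1 *m invmx (blk K1 k.-1 k.-1) *m vblk B x k.-1
     else 0)
    + ((if (0 < k)%N then subdiag A k *m blk M k.-1 k else 0)
       - blk M k k.+1 *m subdiag B k.+1) *m vblk B x k
    + blk M k k.+1 *m vblk B x k.+1.
Proof.
move=> nM MG gB gA Mx.
have [Bi [U [V [iB lU lV TE]]]] := dressed_exchange nM MG gB gA.
have [lB _ dK1 uK1 _] := gB; have [lA _ dK2 _ _] := gA.
have lBi := lut_inv lB (proj1 iB).
have bA := row_band_lut lA; have bM := row_band_nearest nM.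
have bAM := row_band_simul bA bM.
set T := simul (simul A M) Bi in TE.
have bT : row_band 1 T := row_band_dressed lA lBi nM.
have nMt := nearest_shell_tr nM.
(* Transposition turns the upper factors [U] and [V] into lower ones, so that the results on dressed
   blocks apply. *)
have UMV :
    simul (simul U M) V = sitr (simul (simul (sitr V) (sitr M)) (sitr U)).
  rewrite !simul_tr -[LHS]/(simul (simul U M) V).
  by rewrite -(simulA_col (row_band_nearest nMt) (row_band_lut lV)).
have Tsub j : blk T k j = blk K2 k k *m
    (blk (simul (simul (sitr V) (sitr M)) (sitr U)) j k)^T
    *m invmx (blk K1 j j).
  rewrite -blk_tr -UMV -blk_simul_diag_l// -TE.
  rewrite (blk_simul_diag_r _ _ _ _ _ bT)//.
  by rewrite mulmxK.
(* [T B] is [A M], since [Bi] cancels [B], and [M] maps [x] to [L w]. *)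
have -> : L *: vblk A w k = vblk (simul T B) x k.
  rewrite /T -(simulA_row bAM (row_band_lut lBi)) (proj2 iB) simul1r.
  rewrite [RHS]vblkE -(simulA_row bA bM); apply/colP => i; rewrite !mxE.
  rewrite mulr_fsumr; apply: eq_fsbigr => gamma _.
  by rewrite /simul Mx mulrCA.
rewrite (vblk_simul _ _ _ _ _ _ bT (row_band_lut lB)) addn1 !big_ord_recr/=.
rewrite blk_dressed_super// blk_dressed_diag//.
(* [T] contains the inverse [Bi], whose first subdiagonal is opposite to that of [B]: hence the
   minus sign. *)
rewrite /subdiag/= (lut_inv_subdiag k lB lBi (proj1 iB)) mulmxN.
congr (_ + _ + _).
case: k Tsub => [|k] Tsub; first by rewrite big_ord0.
(* The subdiagonal block of [T] comes from a superdiagonal block of the transposed dressed matrix;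
   blocks further left lie outside the band of the latter and vanish. *)
rewrite big_ord_recr/= Tsub blk_dressed_super// blk_tr trmxK.
rewrite big1 ?add0r// => -[j jk] _ /=.
rewrite Tsub (proj1 (row_bandP _ _) (row_band_dressed lV lU nMt)) ?addn1//.
by rewrite trmx0 mulmx0 !mul0mx.
Qed.

(** * Toeplitz matrices *)

Definition toeplitz A : Prop := forall alpha beta gamma : idx,
  A (alpha + gamma) (beta + gamma) = A alpha beta.

Lemma toeplitz_tr A : toeplitz A -> toeplitz (sitr A).
Proof. by move=> tA alpha beta gamma; exact: tA. Qed.

Lemma toeplitz_adj A : toeplitz A -> toeplitz (siadj A).
Proof. by move=> tA alpha beta gamma; rewrite /siadj tA. Qed.

(** Both entries have index difference [beta - alpha]. *)
Lemma toeplitz_opp A alpha beta : toeplitz A ->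
  A (- alpha) (- beta) = A beta alpha.
Proof.
by move=> tA; rewrite -(tA _ _ (alpha + beta)) addKr addrCA addNr addr0.
Qed.

(** The involution [gamma -> alpha + beta - gamma] exchanges the index differences of the two
    factors. Being a bijective reindexing, it also respects the value 0 of infinite sums. *)
Lemma toeplitz_comm A B : toeplitz A -> toeplitz B -> simul A B = simul B A.
Proof.
move=> tA tB; apply/funext => alpha; apply/funext => beta; rewrite /simul.
rewrite (reindex_fsbigT (fun gamma => alpha + beta - gamma)); last first.
  by apply: inv_bij => gamma; exact: subKr.
apply: eq_fsbigr => gamma _; rewrite mulrC; congr (_ * _).
  by rewrite -[RHS](tB _ _ (beta - gamma)) addrA subrKC.
by rewrite -[RHS](tA _ _ (alpha - gamma)) subrKC addrCA addrA.
Qed.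

(** [A] commutes with [G], and moving [eta] past [G] negates both indices of [G], which transposes
    it. *)
Lemma toeplitz_eta_comm A G : toeplitz A -> toeplitz G ->
  simul (simul (@eta C D) A) G = simul (sitr G) (simul (@eta C D) A).
Proof.
move=> tA tG; rewrite simul_eta; apply/funext => alpha; apply/funext => beta.
rewrite -[LHS]/(simul A G (- alpha) beta) toeplitz_comm// /simul.
rewrite [RHS](reindex_fsbigT (fun gamma => - gamma)); last first.
  by apply: inv_bij => gamma; exact: opprK.
apply: eq_fsbigr => gamma _; rewrite opprK; congr (_ * _).
by rewrite -(toeplitz_opp _ _ _ tG) opprK.
Qed.

(** * The matrices [nu] and [eta nu] acting on monomials *)

Lemma deg_opp (alpha : idx) : deg (- alpha) = deg alpha.
Proof. by apply: eq_bigr => a _; rewrite mxE abszN. Qed.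

Lemma deg_add_delta (alpha : idx) a :
  (deg (alpha + delta_mx 0 a) == (deg alpha).+1)
  || (deg alpha == (deg (alpha + delta_mx 0 a)).+1).
Proof.
pose rest := (\sum_(b | b != a) `|alpha 0%R b|)%N.
have -> : deg alpha = (`|alpha 0%R a| + rest)%N by rewrite /deg (bigD1 a).
have -> : deg (alpha + delta_mx 0 a) = (`|(alpha 0 a + 1)%R| + rest)%N.
  rewrite /deg (bigD1 a)//= !mxE !eqxx; congr (_ + _)%N.
  by apply: eq_bigr => b ba; rewrite !mxE (negPf ba) andbF addr0.
lia.
Qed.

Lemma nearest_shell_nu (n : 'cV[C]_(D + D)) : nearest_shell (nu_mx n).
Proof.
move=> alpha beta; apply: contraNT => far.
rewrite /nu_mx big1// => a _; rewrite /Upsilon_inv /Upsilon.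
case: eqP => [ba|_]; first by move: far; rewrite -ba orbC deg_add_delta.
case: eqP => [ab|_]; first by move: far; rewrite -ab deg_add_delta.
by rewrite !mulr0 addr0.
Qed.

Lemma nearest_shell_eta M : nearest_shell M ->
  nearest_shell (simul (@eta C D) M).
Proof. by rewrite simul_eta => nM alpha beta /nM; rewrite deg_opp. Qed.

Lemma toeplitz_nu (n : 'cV[C]_(D + D)) : toeplitz (nu_mx n).
Proof.
move=> alpha beta gamma; apply: eq_bigr => a _.
by rewrite /Upsilon_inv /Upsilon ![_ + gamma + _]addrAC !(inj_eq (addIr gamma)).
Qed.

Lemma monomialD (z : 'rV[C]_D) (alpha beta : idx) : (forall a, z 0 a != 0) ->
  monomial z (alpha + beta) = monomial z alpha * monomial z beta.
Proof.
move=> z0; rewrite -big_split; apply: eq_bigr => a _ /=.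
by rewrite mxE expfzDr.
Qed.

Lemma monomialN (z : 'rV[C]_D) (alpha : idx) :
  monomial z (- alpha) = monomial (invz z) alpha.
Proof. by apply: eq_bigr => a _; rewrite !mxE exprz_inv. Qed.

Lemma monomial_delta (z : 'rV[C]_D) a : monomial z (delta_mx 0 a) = z 0 a.
Proof.
rewrite /monomial (bigD1 a)//= mxE !eqxx expr1z big1 ?mulr1// => b ba.
by rewrite mxE (negPf ba) andbF expr0z.
Qed.

Lemma fsum_pick (alpha : idx) x :
  \sum_(gamma \in [set: idx]) (alpha == gamma)%:R * x gamma = x alpha.
Proof. by have := congr1 (fun X => X alpha alpha) (simul1l (column x)). Qed.

(** Row [alpha] of [nu] is supported on the neighbours of [alpha], and a step by a unit vector
    multiplies the monomial by a coordinate of z or its inverse. *)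
Lemma nu_monomial (n : 'cV[C]_(D + D)) (z : 'rV[C]_D) :
  (forall a, z 0 a != 0) -> forall alpha : idx,
  \sum_(gamma \in [set: idx]) nu_mx n alpha gamma * monomial z gamma
  = Lpoly n z * monomial z alpha.
Proof.
move=> z0 alpha.
have degD a : (deg (alpha + delta_mx 0%R a)%R < (deg alpha).+2)%N.
  by have := deg_add_delta alpha a; lia.
have degB a : (deg (alpha - delta_mx 0%R a)%R < (deg alpha).+2)%N.
  by have := deg_add_delta (alpha - delta_mx 0 a) a; rewrite subrK; lia.
have pick_far (beta gamma : idx) (c : C) : (deg beta < (deg alpha).+2)%N ->
    ((deg alpha).+2 <= deg gamma)%N -> (beta == gamma)%:R * c = 0.
  move=> db dg; case: eqP => [bg|_]; last by rewrite mul0r.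
  by move: db; rewrite bg ltnNge dg.
have nuE gamma : nu_mx n alpha gamma * monomial z gamma =
    \sum_a (n_neg n a * ((alpha - delta_mx 0 a == gamma)%:R * monomial z gamma)
            + n_pos n a
              * ((alpha + delta_mx 0 a == gamma)%:R * monomial z gamma)).
  rewrite mulr_suml; apply: eq_bigr => a _; rewrite mulrDl -!mulrA.
  by rewrite /Upsilon_inv /Upsilon subr_eq [alpha == gamma + _]eq_sym.
(* All neighbours have degree at most [deg alpha + 1]. The finite list permits exchanging the sums
   over [gamma] and [a]; afterwards each inner sum becomes a full sum again and picks one
   neighbour. *)
rewrite (@fsum_shells (deg alpha).+2); last first.
  move=> gamma far; rewrite nuE big1// => a _.
  by rewrite !pick_far// !mulr0 addr0.
under eq_bigr do rewrite nuE.
rewrite exchange_big mulr_suml/=; apply: eq_bigr => a _.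
rewrite big_split/= -!mulr_sumr -!fsum_shells; last 2 first.
- by move=> gamma; exact: pick_far.
- by move=> gamma; exact: pick_far.
rewrite !fsum_pick !monomialD// monomialN !monomial_delta !mxE.
by rewrite mulrDl -!mulrA [(z 0 a)^-1 * _]mulrC [z 0 a * _]mulrC.
Qed.

(** * The four relations, for Toeplitz matrices and for the moment matrix *)

Lemma invmx_adj m (E : 'M[C]_m) : (invmx E)^t* = invmx (E^t*).
Proof. by rewrite -map_invmx trmx_inv. Qed.

(** The pairs [(G1, G2)] are, in order, [G] twice, [siadj G] twice, [(G, sitr G)] and
    [(sitr G, G)]. *)
Lemma toeplitz_three_term {G S H Sh : simx} (n : 'cV[C]_(D + D)) (k : nat)
  (z : 'rV[C]_D) : toeplitz G -> gauss_borel G S H Sh ->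
  (forall a, z 0 a != 0) ->
  let nu := nu_mx n in
  let etanu := simul (@eta _ D) nu in
  let Hb j := blk H j j in
  let beta := subdiag S in
  let betah := subdiag Sh in
  let betahc := subdiag (siconj Sh) in
  let phi := oblock S in
  let phih := oblock Sh in
  let phihc := oblock (siconj Sh) in
  [/\ Lpoly n z *: phi k z
      = (if (0 < k)%N then
           Hb k *m blk nu k k.-1 *m invmx (Hb k.-1) *m phi k.-1 z else 0)
        + ((if (0 < k)%N then beta k *m blk nu k.-1 k else 0)
           - blk nu k k.+1 *m beta k.+1) *m phi k z
        + blk nu k k.+1 *m phi k.+1 z,
      Lpoly n z *: phih k z
      = (if (0 < k)%N then
           (Hb k)^t* *m blk nu k k.-1 *m (invmx (Hb k.-1))^t* *m phih k.-1 z
         else 0)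
        + ((if (0 < k)%N then betah k *m blk nu k.-1 k else 0)
           - blk nu k k.+1 *m betah k.+1) *m phih k z
        + blk nu k k.+1 *m phih k.+1 z,
      Lpoly n z *: phihc k (invz z)
      = (if (0 < k)%N then
           (Hb k)^T *m blk etanu k k.-1 *m invmx (Hb k.-1) *m phi k.-1 z
         else 0)
        + ((if (0 < k)%N then betahc k *m blk etanu k.-1 k else 0)
           - blk etanu k k.+1 *m beta k.+1) *m phi k z
        + blk etanu k k.+1 *m phi k.+1 z
    & Lpoly n z *: phi k (invz z)
      = (if (0 < k)%N then
           Hb k *m blk etanu k k.-1 *m invmx (Hb k.-1)^T *m phihc k.-1 z
         else 0)
        + ((if (0 < k)%N then beta k *m blk etanu k.-1 k else 0)
           - blk etanu k k.+1 *m betahc k.+1) *m phihc k z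
        + blk etanu k k.+1 *m phihc k.+1 z].
Proof.
move=> tG hG hz nu etanu Hb beta betah betahc phi phih phihc.
have tnu : toeplitz nu := toeplitz_nu n.
have nnu : nearest_shell nu := nearest_shell_nu n.
have nenu : nearest_shell etanu := nearest_shell_eta _ nnu.
have Lz := nu_monomial n _ hz.
have Lzi (alpha : 'rV[int]_D) :
    \sum_(gamma \in [set: 'rV[int]_D]) etanu alpha gamma * monomial z gamma
    = Lpoly n z * monomial (invz z) alpha.
  by rewrite /etanu simul_eta Lz monomialN.
split.
- exact: (three_term _ _ nnu (toeplitz_comm _ _ tnu tG) hG hG Lz).
- have tG' := toeplitz_adj _ tG; have hG' := gauss_borel_adj hG.
  have := three_term _ k nnu (toeplitz_comm _ _ tnu tG') hG' hG' Lz.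
  rewrite !blk_adj -invmx_adj. exact.
- have := three_term _ k nenu (toeplitz_eta_comm _ _ tnu tG)
    hG (gauss_borel_tr hG) Lzi.
  rewrite (blk_tr H). exact.
(* For [sitr G] the exchange produces [sitr (sitr G)], which is [G] by conversion. *)
- have tG' := toeplitz_tr _ tG.
  have := three_term _ k nenu (toeplitz_eta_comm _ _ tnu tG')
    (gauss_borel_tr hG) hG Lzi.
  rewrite (blk_tr H). exact.
Qed.
End SemiInfiniteAlgebra.

(** The integrands already agree: a common shift by [gamma] contributes the squared modulus of a
    monomial, which is 1 on the torus. *)
Lemma toeplitz_moment_mx (R : realType) (D : nat)
  (mu : {charge set borel_torus R D -> \bar R[i]}) : toeplitz (moment_mx mu).
Proof.
move=> alpha beta gamma; congr complex_integral; apply/funext => t.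
have t1 a : `|torus_val t 0 a| = 1.
  by apply/eqP; move: a; apply/forallP; exact: (valP t).
have t0 a : torus_val t 0 a != 0 by rewrite -normr_eq0 t1 oner_eq0.
rewrite !monomialD// rmorphM mulrACA -normCK.
have -> : `|monomial (torus_val t) gamma| = 1; last by rewrite expr1n mulr1.
rewrite normr_prod big1// => a _; rewrite /exprz.
by case: (gamma 0 a) => m; rewrite ?normfV normrX t1 expr1n ?invr1.
Qed.

Theorem proposition2p26 (R : realType) (D : nat) (hD : (1 <= D)%N)
  (mu : {charge set borel_torus R D -> \bar R[i]})
  (hmu : quasi_definite (moment_mx mu))
  (S H Sh : simx R[i] D) (hG : gauss_borel (moment_mx mu) S H Sh)
  (n : 'cV[R[i]]_(D + D)) (k : nat)
  (z : 'rV[R[i]]_D) (hz : forall a, z 0 a != 0) :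
  let nu := nu_mx n in
  let etanu := simul (@eta _ D) nu in
  let Hb j := blk H j j in
  let beta := subdiag S in
  let betah := subdiag Sh in
  let betahc := subdiag (siconj Sh) in
  let phi := oblock S in
  let phih := oblock Sh in
  let phihc := oblock (siconj Sh) in
  [/\ Lpoly n z *: phi k z
      = (if (0 < k)%N then
           Hb k *m blk nu k k.-1 *m invmx (Hb k.-1) *m phi k.-1 z else 0)
        + ((if (0 < k)%N then beta k *m blk nu k.-1 k else 0)
           - blk nu k k.+1 *m beta k.+1) *m phi k z
        + blk nu k k.+1 *m phi k.+1 z,
      Lpoly n z *: phih k z
      = (if (0 < k)%N then
           (Hb k)^t* *m blk nu k k.-1 *m (invmx (Hb k.-1))^t* *m phih k.-1 z
         else 0)
        + ((if (0 < k)%N then betah k *m blk nu k.-1 k else 0)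
           - blk nu k k.+1 *m betah k.+1) *m phih k z
        + blk nu k k.+1 *m phih k.+1 z,
      Lpoly n z *: phihc k (invz z)
      = (if (0 < k)%N then
           (Hb k)^T *m blk etanu k k.-1 *m invmx (Hb k.-1) *m phi k.-1 z
         else 0)
        + ((if (0 < k)%N then betahc k *m blk etanu k.-1 k else 0)
           - blk etanu k k.+1 *m beta k.+1) *m phi k z
        + blk etanu k k.+1 *m phi k.+1 z
    & Lpoly n z *: phi k (invz z)
      = (if (0 < k)%N then
           Hb k *m blk etanu k k.-1 *m invmx (Hb k.-1)^T *m phihc k.-1 z
         else 0)
        + ((if (0 < k)%N then beta k *m blk etanu k.-1 k else 0)
           - blk etanu k k.+1 *m betahc k.+1) *m phihc k z
        + blk etanu k k.+1 *m phihc k.+1 z].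
Proof.
exact: (toeplitz_three_term n k z (toeplitz_moment_mx _ _ mu) hG hz).
Qed.
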